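(* For every $n$ and every $1\le j\le n$, $\widetilde{H}_{j-1}(D_n)\cong\mathbb{Z}^{D(n,j,j)}$, where $D(n,j,j)$ is the number of partitions of $[n]$ into exactly $j$ blocks, none of which is a singleton.
   Context: $[n]=\{1,\dots,n\}$. A partial partition of $[n]$ is a set of pairwise disjoint nonempty subsets (blocks) of $[n]$. $D_n$ is the abstract simplicial complex whose vertices are the nonempty subsets of $[n]$ and whose faces are the partial partitions of $[n]$ (ordered by inclusion). $\widetilde{H}_\ast$ denotes reduced simplicial homology with integer coefficients. *)

(* Defs.v *)
From HB Require Import structures.
From mathcomp Require Import all_boot all_order all_algebra.
From mathcomp Require Import boolp.
From mathcomp Require Import zify.

Set Implicit Arguments.
Unset Strict Implicit.
Unset Printing Implicit Defensive.

Import Order.TTheory GRing.Theory Num.Theory.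
Local Open Scope ring_scope.

(* Every element of V is a vertex, and the empty face (of dimension -1) always
   belongs to the complex, as needed for the augmented chain complex. *)
Record simplicial_complex (V : finType) := SimplicialComplex {
  faces :> {set {set V}};
  face0 : set0 \in faces;
  face1 : forall v : V, [set v] \in faces;
  face_sub : forall F G : {set V}, F \in faces -> G \subset F -> G \in faces
}.

Section Homology.
Variables (V : finType) (K : simplicial_complex V).

(* The faces with m vertices, i.e. of dimension m - 1. *)
Definition simplex (m : nat) := {F : {set V} | (F \in faces K) && (#|F| == m)}.

(* Faces are oriented by the enumeration order of V: enum F lists the vertices
   v_0, ..., v_k of F in increasing order. *)
Definition chain (m : nat) := {ffun simplex m -> int}.

(* The coefficient of G in
   boundary [v_0, ..., v_k] = \sum_i (-1)^i [v_0, ..., v_i omitted, ..., v_k]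
   where F = {v_0, ..., v_k}. *)
Definition incidence (F G : {set V}) : int :=
  \sum_(v in F | F :\ v == G) (-1) ^+ index v (enum F).

(* The boundary on faces with one vertex (m = 0) is the augmentation. *)
Definition boundary (m : nat) (c : chain m.+1) : chain m :=
  [ffun G : simplex m =>
     \sum_(F : simplex m.+1) c F * incidence (val F) (val G)].

Fact boundary_is_zmod_morphism (m : nat) : zmod_morphism (@boundary m).
Proof.
move=> c d; apply/ffunP => G; rewrite !ffunE -sumrB; apply: eq_bigr => F _.
by rewrite !ffunE mulrBl.
Qed.

HB.instance Definition _ (m : nat) :=
  GRing.isZmodMorphism.Build (chain m.+1) (chain m) (@boundary m)
    (@boundary_is_zmod_morphism m).

Definition cycle_pred (m : nat) : {pred chain m.+1} :=
  [pred c | boundary c == 0].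

Fact cycle_zmod_closed (m : nat) : zmod_closed (@cycle_pred m).
Proof.
split=> [|c d]; rewrite !inE ?raddf0 // => /eqP c0 /eqP d0.
by rewrite raddfB /= c0 d0 subr0.
Qed.

HB.instance Definition _ (m : nat) :=
  GRing.isZmodClosed.Build (chain m.+1) (@cycle_pred m) (@cycle_zmod_closed m).

Record cycle_group (m : nat) := Cycle {
  cycle_val :> chain m.+1;
  _ : cycle_val \in @cycle_pred m
}.

HB.instance Definition _ (m : nat) := [isSub for @cycle_val m].
HB.instance Definition _ (m : nat) := [Choice of cycle_group m by <:].
HB.instance Definition _ (m : nat) :=
  [SubChoice_isSubZmodule of cycle_group m by <:].

Definition boundary_pred (m : nat) : {pred cycle_group m} :=
  [pred z : cycle_group m | `[< exists c : chain m.+2, boundary c = val z >]].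

Fact boundary_zmod_closed (m : nat) : zmod_closed (@boundary_pred m).
Proof.
split=> [|y z]; rewrite !inE.
  by apply/asboolP; exists 0; rewrite !raddf0.
move=> /asboolP[c cy] /asboolP[d dz]; apply/asboolP; exists (c - d).
by rewrite !raddfB /= cy dz.
Qed.

HB.instance Definition _ (m : nat) :=
  GRing.isZmodClosed.Build (cycle_group m) (@boundary_pred m)
    (@boundary_zmod_closed m).

(* cycle_group m consists of combinations of faces with m + 1 vertices, so this
   is the reduced homology group in dimension m. *)
Definition reduced_homology (m : nat) : zmodType :=
  Quotient.quot (@boundary_pred m).

Lemma index_enum_card (F : {set V}) (v : V) : v \in F ->
  index v (enum F) = #|[set w in F | (enum_rank w < enum_rank v)%N]|.
Proof.
move=> vF.
have sE : sorted (fun x y : V => (enum_rank x < enum_rank y)%N) (enum F).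
  rewrite {1}/enum_mem; apply: sorted_filter.
    by move=> x y z; apply: ltn_trans.
  rewrite -enumT.
  suff : sorted ltn [seq (enum_rank x : nat) | x <- enum V].
    by rewrite sorted_map.
  suff -> : [seq (enum_rank x : nat) | x <- enum V] = iota 0 #|V|.
    by apply: iota_ltn_sorted.
  apply: (@eq_from_nth _ 0%N); first by rewrite size_map size_iota cardE.
  move=> i; rewrite size_map -cardE => ltiV.
  rewrite (nth_map v) -?cardE // nth_iota // add0n.
  have -> : nth v (enum V) i = enum_val (Ordinal ltiV : 'I_#|V|).
    by rewrite (enum_val_nth v).
  by rewrite enum_valK.
move: (enum_uniq F) (mem_enum F) sE; move: (enum F) => s Us sF sE.
have vs : v \in s by rewrite sF.
have -> : #|[set w in F | (enum_rank w < enum_rank v)%N]|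
         = count (fun w => enum_rank w < enum_rank v)%N s.
  rewrite -size_filter -(card_uniqP (filter_uniq _ Us)).
  by apply: eq_card => w; rewrite !inE mem_filter sF andbC.
case/splitPr: vs Us sE {sF} => s1 s2 Us.
rewrite sorted_pairwise; last by move=> x y z; apply: ltn_trans.
rewrite pairwise_cat /= => /and3P[/allrelP r1 _ /andP[/allP r2 _]].
move: Us; rewrite cat_uniq /= => /and3P[_ /norP[vs1 _] _].
rewrite index_cat (negPf vs1) /= eqxx addn0 count_cat /= ltnn add0n.
rewrite (eq_in_count (a2 := predT)) ?count_predT; last first.
  by move=> w ws1; rewrite /= r1 // inE eqxx.
rewrite (eq_in_count (a2 := pred0)) ?count_pred0 ?addn0 // => w /r2 /ltnW.
by rewrite leqNgt => /negPf.
Qed.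

Lemma incidence_swap (F : {set V}) (v w : V) : v \in F -> w \in F -> v != w ->
  (-1) ^+ index v (enum F) * (-1) ^+ index w (enum (F :\ v)) =
  - ((-1) ^+ index w (enum F) * (-1) ^+ index v (enum (F :\ w))) :> int.
Proof.
wlog ltvw : v w / (enum_rank v < enum_rank w)%N.
  move=> IH vF wF nvw.
  case: (ltngtP (enum_rank v) (enum_rank w)) => [lt|gt|/val_inj/enum_rank_inj e].
  - exact: IH.
  - by rewrite (IH w v) // 1?eq_sym // opprK.
  - by rewrite e eqxx in nvw.
move=> vF wF nvw.
rewrite (index_enum_card vF) (index_enum_card wF).
rewrite [index w _]index_enum_card; last by rewrite !inE eq_sym nvw.
rewrite [index v _]index_enum_card; last by rewrite !inE nvw.
have -> : [set x in F :\ w | (enum_rank x < enum_rank v)%N]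
        = [set x in F | (enum_rank x < enum_rank v)%N].
  apply/setP => x; rewrite !inE; case: eqVneq => [->|] //=.
  by rewrite [RHS]andbC ltnNge (ltnW ltvw).
rewrite [in RHS](cardsD1 v) inE vF ltvw /= add1n exprS mulN1r mulNr opprK mulrC.
congr (_ ^+ _ * _); apply: eq_card => x; rewrite !inE.
by rewrite andbA.
Qed.

Lemma boundary_boundary (m : nat) (c : chain m.+2) : boundary (boundary c) = 0.
Proof.
apply/ffunP => H; rewrite !ffunE.
under eq_bigr => G _ do rewrite ffunE mulr_suml.
rewrite exchange_big big1 //= => F _.
under eq_bigr => G _ do rewrite -mulrA.
rewrite -mulr_sumr [X in _ * X](_ : _ = 0) ?mulr0 //.
have /andP[FK /eqP cF] := valP F.
pose T v w : int :=
  (-1) ^+ index v (enum (val F)) * (-1) ^+ index w (enum (val F :\ v)).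
pose P v w := [&& v \in val F, w \in val F, v != w & val F :\ v :\ w == val H].
transitivity (\sum_v \sum_(w | P v w) T v w).
  rewrite /incidence.
  under eq_bigr => G _ do rewrite mulr_suml big_mkcondr /=.
  rewrite exchange_big [RHS]big_mkcond [LHS]big_mkcond /=.
  apply: eq_bigr => v _; case: ifP => vF; last first.
    by rewrite big_pred0 // => w; rewrite /P vF.
  have vK : (val F :\ v \in faces K) && (#|val F :\ v| == m.+1).
    rewrite (face_sub FK (subsetDl _ _)) /=.
    by apply/eqP; move: cF; rewrite (cardsD1 v) vF add1n => -[].
  rewrite (bigD1 (Sub (val F :\ v) vK : simplex m.+1)) //= eqxx.
  rewrite [X in _ + X]big1 ?addr0; last first.
    move=> G nG; case: ifP => // /eqP e; case/negP: nG; apply/eqP/val_inj.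
    by rewrite /= e.
  rewrite mulr_sumr; apply: eq_bigl => w; rewrite /P vF !inE /=.
  by rewrite eq_sym andbA [_ && (v != w)]andbC.
set S := (X in X = 0).
suff : S = - S by lia.
rewrite {1}/S (exchange_big_dep xpredT) //= /S -sumrN; apply: eq_bigr => v _.
rewrite -sumrN; apply: eq_big => [w|w /and4P[wF vF nwv _]].
  rewrite /P eq_sym andbCA; congr [&& _, _, _ & _ == _].
  by rewrite !setDDl setUC.
exact: incidence_swap.
Qed.

End Homology.

Definition isomorphic_zmod (A B : zmodType) : Prop :=
  exists f : {additive A -> B}, bijective f.

Section PartialPartitions.
Variable n : nat.

Definition partial_partition (P : {set {set 'I_n}}) : bool :=
  trivIset P && (set0 \notin P).

Definition nonempty_subset := {B : {set 'I_n} | B != set0}.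

Definition Dn_faces : {set {set nonempty_subset}} :=
  [set P : {set nonempty_subset} | partial_partition [set val B | B in P]].

Fact Dn_face0 : set0 \in Dn_faces.
Proof.
rewrite inE /partial_partition imset0 inE andbT.
by apply/trivIsetP => A B; rewrite inE.
Qed.

Fact Dn_face1 (B : nonempty_subset) : [set B] \in Dn_faces.
Proof.
rewrite inE /partial_partition imset_set1 inE eq_sym (valP B) andbT.
by apply/trivIsetP => A C /set1P-> /set1P->; rewrite eqxx.
Qed.

Fact Dn_face_sub (P Q : {set nonempty_subset}) :
  P \in Dn_faces -> Q \subset P -> Q \in Dn_faces.
Proof.
rewrite !inE => /andP[tP P0] QP; have sQP := imsetS val QP.
by rewrite /partial_partition (trivIsetS sQP tP) (contra (subsetP sQP _) P0).
Qed.

Definition Dn : simplicial_complex nonempty_subset :=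
  SimplicialComplex Dn_face0 Dn_face1 Dn_face_sub.

Definition num_nosingleton_partitions (j : nat) : nat :=
  #|[set P : {set {set 'I_n}} |
     [&& partition P [set: 'I_n], #|P| == j & [forall B in P, #|B| != 1%N]]]|.

End PartialPartitions.

(* Main.v *)
Require Import Defs.
From mathcomp Require Import all_boot all_order all_algebra.
From HB Require Import structures.
From mathcomp Require Import boolp zify ring.

(** Write [v_i] for the vertex [{i}], and call a face critical if it is a
    partition of [[n]] without singletons.  The critical faces are maximal, and
    a face [P] is non-critical exactly when [v_i |: P] is a face for some [i].
    So the non-critical faces form the union [L] of the stars of the [v_i].
    Adding the stars one at a time, each meets the union of the previous ones in
    a cone with apex [v_i], because [v_i |: P] and [v_k |: P] being faces makes
    [v_i |: (v_k |: P)] one; hence [L] is acyclic.  The homology of the complex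
    is therefore the relative homology of the pair, which is free on the
    critical faces. *)

Set Implicit Arguments.
Unset Strict Implicit.
Unset Printing Implicit Defensive.

Import GRing.Theory.

(** * Ungraded chains on the full simplex: boundary, cones, acyclicity *)

Section TotalChains.
Local Open Scope ring_scope.
Variable V : finType.
Implicit Types (F G : {set V}) (v w : V) (A B : {set {set V}}).

(* Ungraded chains of the full simplex on V, including the empty face. *)
Local Notation tchain := {ffun {set V} -> int}.
Implicit Types c d z : tchain.

Definition vsign F v : int := (-1) ^+ index v (enum F).

(** The simplicial boundary read coefficientwise: the sets having [G] as a facet are the [v |: G]
    with [v] outside [G]. *)
Definition bd c : tchain :=
  [ffun G : {set V} => \sum_(v | v \notin G) vsign (v |: G) v * c (v |: G)].

(** The signed join with [v]; it kills the faces that already contain [v]. *)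
Definition cone v c : tchain :=
  [ffun F : {set V} => if v \in F then vsign F v * c (F :\ v) else 0].

Definition supported A c := forall F, F \notin A -> c F = 0.

(** All degrees at once, empty face included: for [A] closed under subsets, all reduced homology
    vanishes. *)
Definition acyclic A :=
  forall z, supported A z -> bd z = 0 -> exists2 c, supported A c & bd c = z.

Definition restrict A c : tchain := [ffun F => if F \in A then c F else 0].

Lemma vsign_sqr F v : vsign F v * vsign F v = 1.
Proof. by rewrite /vsign -signr_odd -expr2 sqrr_sign. Qed.

Lemma vsign_swap F v w : v \in F -> w \in F -> v != w ->
  vsign F v * vsign (F :\ v) w = - (vsign F w * vsign (F :\ w) v).
Proof. exact: incidence_swap. Qed.

Lemma bd_is_zmod_morphism : zmod_morphism bd.
Proof.
move=> c d; apply/ffunP => G; rewrite !ffunE -sumrB.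
by apply: eq_bigr => v _; rewrite !ffunE mulrBr.
Qed.

HB.instance Definition _ :=
  GRing.isZmodMorphism.Build tchain tchain bd bd_is_zmod_morphism.

Lemma bd_bd c : bd (bd c) = 0.
Proof.
apply/ffunP => G; rewrite !ffunE.
pose P v w := [&& v \notin G, w \notin G & v != w].
pose T v w := vsign (v |: G) v * vsign (w |: (v |: G)) w * c (w |: (v |: G)).
transitivity (\sum_v \sum_(w | P v w) T v w).
  rewrite big_mkcond; apply: eq_bigr => v _; rewrite /P.
  case: ifP => /= vG; last by rewrite big_pred0.
  rewrite ffunE mulr_sumr; apply: eq_big => [w|w _]; last by rewrite mulrA.
  by rewrite !inE negb_or andbC eq_sym.
set S := (X in X = 0).
(* Exchanging the order in which [v] and [w] are added reverses the sign of each term. *)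
suff : S = - S by lia.
rewrite {1}/S (exchange_big_dep xpredT) //= /S -sumrN; apply: eq_bigr => v _.
rewrite -sumrN; apply: eq_big => [w|w /and3P[wG vG nwv]].
  by rewrite /P eq_sym andbCA.
rewrite /T [v |: (w |: G)]setUCA -mulNr; congr (_ * _).
have nvw : v != w by rewrite eq_sym.
have := @vsign_swap (w |: (v |: G)) v w.
have -> : (w |: (v |: G)) :\ v = w |: G.
  by rewrite setUCA setU1K // !inE negb_or nvw.
rewrite setU1K ?inE ?negb_or ?nwv // !eqxx orbT => /(_ isT isT nvw) e.
by rewrite mulrC e mulrC.
Qed.

(** [cone v] is a contracting homotopy. At [G] avoiding [v] only the term of [v] survives; at [G]
    containing [v] that term gives [c G] and the others cancel by [vsign_swap]. *)
Lemma bd_cone v c : bd (cone v c) + cone v (bd c) = c.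
Proof.
apply/ffunP => G; rewrite !ffunE; case: ifP => vG; last first.
  rewrite addr0 (bigD1 v) ?vG //= ffunE setU11 setU1K ?vG // mulrA vsign_sqr.
  rewrite mul1r big1 ?addr0 // => w /andP[wG wv].
  by rewrite ffunE !inE vG orbF eq_sym (negPf wv) mulr0.
rewrite (bigD1 (P := fun w => w \notin G :\ v) v) ?inE ?eqxx //=.
rewrite setD1K // mulrDr [vsign G v * _]mulrA vsign_sqr mul1r.
rewrite addrCA mulr_sumr.
rewrite [X in _ + (_ + X)](eq_bigl (fun w => w \notin G)); last first.
  move=> w; rewrite !inE negb_and negbK; case: (eqVneq w v) => [->|_].
    by rewrite vG.
  by rewrite /= andbT.
rewrite -big_split big1 ?addr0 //= => w wG.
have nwv : w != v by apply: contraNneq wG => ->.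
rewrite ffunE inE vG orbT.
have e1 : (w |: G) :\ v = w |: G :\ v.
  by rewrite setDUl; congr (_ :|: _); apply/setDidPl; rewrite disjoints1 inE.
rewrite e1.
have := @vsign_swap (w |: G) w v; rewrite !inE eqxx vG orbT nwv.
move=> /(_ isT isT isT); rewrite setU1K // e1.
have := vsign_sqr G v; have := vsign_sqr (w |: G) v.
set a := vsign (w |: G) w; set b := vsign (w |: G) v; set p := vsign G v.
set q := vsign (w |: G :\ v) w; set x := c _ => bb pp e.
(* The factor [b * b = 1] is inserted to create [b * q], which [e] turns into [- (a * p)]. *)
have -> : p * (q * x) = b * q * p * x * b by rewrite -[LHS]mulr1 -bb; ring.
have -> : b * q * p * x * b = - (a * (p * p) * x * b).
  by rewrite -[b * q]opprK -e; ring.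
by rewrite pp; ring.
Qed.

Lemma bd_supported A c : (forall F G, F \in A -> G \subset F -> G \in A) ->
  supported A c -> supported A (bd c).
Proof.
move=> Asub Ac F FA; rewrite ffunE big1 // => v _.
by rewrite Ac ?mulr0 //; apply: contra FA => /Asub; apply; rewrite subsetUr.
Qed.

Lemma cone_supported A v c : (forall F, F \in A -> v |: F \in A) ->
  supported A c -> supported A (cone v c).
Proof.
move=> Av Ac F FA; rewrite ffunE; case: ifP => // vF.
by rewrite Ac ?mulr0 //; apply: contra FA => /Av; rewrite setD1K.
Qed.

Lemma supportedS A B c : A \subset B -> supported A c -> supported B c.
Proof. by move=> /subsetP AB Ac F FB; apply/Ac/(contra _ FB)/AB. Qed.

Lemma supportedB A c d : supported A c -> supported A d -> supported A (c - d).
Proof. by move=> Ac Ad F FA; rewrite !ffunE Ac // Ad // subrr. Qed.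

Lemma supportedD A c d : supported A c -> supported A d -> supported A (c + d).
Proof. by move=> Ac Ad F FA; rewrite !ffunE Ac // Ad // addr0. Qed.

Lemma restrict_supported A c : supported A (restrict A c).
Proof. by move=> F FA; rewrite ffunE (negPf FA). Qed.

(** * Acyclicity of unions of vertex stars *)

Variable K : simplicial_complex V.

Definition stars (s : seq V) : {set {set V}} :=
  [set F in faces K | has (fun v => v |: F \in faces K) s].

Lemma stars_sub s F G : F \in stars s -> G \subset F -> G \in stars s.
Proof.
rewrite !inE => /andP[FK /hasP[v vs vF]] GF; rewrite (face_sub FK GF) /=.
by apply/hasP; exists v => //; apply: face_sub vF _; apply: setUS.
Qed.

Lemma acyclic_stars s :
  (forall v w F, v \in s -> w \in s -> v |: F \in faces K ->
     w |: F \in faces K -> v |: (w |: F) \in faces K) ->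
  acyclic (stars s).
Proof.
elim: s => [|v s IHs] flag z zs dz.
  have -> : z = 0 by apply/ffunP => F; rewrite zs ?ffunE // inE andbF.
  by exists 0; rewrite ?raddf0 // => F _; rewrite ffunE.
have {}IHs : acyclic (stars s).
  by apply: IHs => u w F us ws; apply: flag; rewrite inE ?us ?ws orbT.
(* A Mayer-Vietoris splitting: [z1] lies on the stars of [s], [z2] on the star of [v]. *)
pose z1 := restrict (stars s) z; pose z2 := z - z1.
have starsE : stars (v :: s) = stars [:: v] :|: stars s.
  by apply/setP => F; rewrite !inE /= orbF andb_orr.
have z2v : supported (stars [:: v]) z2.
  move=> F Fv; rewrite !ffunE; case: ifP => Fs; first by rewrite subrr.
  by rewrite subr0 zs // starsE inE negb_or Fv Fs.
have star_add F : F \in stars [:: v] -> v |: F \in stars [:: v].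
  by rewrite !inE /= !orbF setUA setUid => /andP[_ ->].
(* By [flag], the intersection is a cone with apex [v]. *)
have inter_add F : F \in stars [:: v] :&: stars s ->
    v |: F \in stars [:: v] :&: stars s.
  rewrite !inE /= !orbF setUA setUid.
  move=> /andP[/andP[FK vF] /andP[_ /hasP[w ws wF]]].
  by rewrite vF /=; apply/hasP; exists w => //; apply: flag;
    rewrite ?inE ?eqxx ?ws ?orbT.
(* The support lies in [stars s] because [bd z2 = - bd z1], [z] being a cycle. *)
have dz2 : supported (stars [:: v] :&: stars s) (bd z2).
  move=> F; rewrite inE negb_and => /orP[Fv|Fs].
    exact: (bd_supported (@stars_sub _) z2v).
  rewrite raddfB /= dz sub0r ffunE.
  by rewrite (bd_supported (@stars_sub _) (@restrict_supported (stars s) z)) //.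
(* By [bd_cone], trading [z2] for [cone v (bd z2)] changes [z] by a boundary and moves it into
   [stars s]. *)
pose z3 := z1 + cone v (bd z2).
have z3E : z3 = z - bd (cone v z2).
  rewrite -[in RHS](subrK z1 z) -/z2 -{1}(bd_cone v z2) /z3.
  by rewrite addrAC [X in X - _]addrC addrK addrC.
have [||c cs dc] := IHs z3.
- apply: supportedD; first exact: restrict_supported.
  exact: supportedS (subsetIr _ _) (cone_supported inter_add dz2).
- by rewrite z3E raddfB /= bd_bd dz subr0.
exists (c + cone v z2); last by rewrite raddfD /= dc z3E subrK.
rewrite starsE; apply: supportedD; first exact: supportedS (subsetUr _ _) cs.
exact: supportedS (subsetUl _ _) (cone_supported star_add z2v).
Qed.

End TotalChains.

(** * Passage between graded and ungraded chains *)

Section GradedChains.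
Local Open Scope ring_scope.
Variables (V : finType) (K : simplicial_complex V).
Local Notation tchain := {ffun {set V} -> int}.

Definition ext m (c : chain K m) : tchain :=
  [ffun F : {set V} => oapp c 0%R (insub F : option (simplex K m))].

Definition res m (c : tchain) : chain K m :=
  [ffun s : simplex K m => c (val s)].

Lemma extK m : cancel (@ext m) (@res m).
Proof. by move=> c; apply/ffunP => s; rewrite !ffunE valK. Qed.

Lemma ext_supported m (c : chain K m) : supported (faces K) (ext c).
Proof. by move=> F FK; rewrite ffunE insubF // (negPf FK). Qed.

Lemma ext_is_zmod_morphism m : zmod_morphism (@ext m).
Proof.
move=> c d; apply/ffunP => F; rewrite !ffunE.
by case: insubP => [s _ _|_]; rewrite /= ?ffunE ?subr0.
Qed.

HB.instance Definition _ m :=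
  GRing.isZmodMorphism.Build (chain K m) tchain (@ext m)
    (@ext_is_zmod_morphism m).

Lemma ext_res m (c : tchain) F : supported (faces K) c ->
  ext (res m c) F = if #|F| == m then c F else 0.
Proof.
move=> cK; rewrite ffunE; case: insubP => [s /andP[_ ->] <-|] /=.
  by rewrite ffunE.
by rewrite negb_and => /orP[/cK ->|/negPf->]; rewrite ?if_same.
Qed.

Lemma boundary_res m (c : tchain) : supported (faces K) c ->
  boundary (res m.+1 c) = res m (bd c).
Proof.
move=> cK; apply/ffunP => G; rewrite !ffunE.
have /andP[GK /eqP cG] := valP G.
under eq_bigr => F _ do rewrite ffunE /incidence mulr_sumr.
rewrite (exchange_big_dep xpredT) //= [RHS]big_mkcond; apply: eq_bigr => v _.
case: ifP => vG; last first.
  rewrite big_pred0 // => F; apply/negP => /andP[_ /eqP e].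
  by rewrite -e !inE eqxx in vG.
(* This matches the facets removed in [incidence] with the vertices added in [bd]. *)
have eF (F : simplex K m.+1) :
    (v \in val F) && (val F :\ v == val G) = (val F == v |: val G).
  apply/andP/eqP => [[vF /eqP <-]|->]; first by rewrite setD1K.
  by rewrite setU11 setU1K.
rewrite (eq_bigl _ _ eF).
have [vK|vK] := boolP (v |: val G \in faces K); last first.
  rewrite cK // mulr0 big_pred0 // => F; apply/eqP => e.
  by case/andP: (valP F); rewrite e (negPf vK).
have sP : (v |: val G \in faces K) && (#|v |: val G| == m.+1).
  by rewrite vK cardsU1 vG cG add1n eqxx.
rewrite (big_pred1 (Sub (v |: val G) sP : simplex K m.+1)) => [|F] /=.
  by rewrite mulrC.
by rewrite -val_eqE.
Qed.

Lemma bd_ext m (c : chain K m.+1) : bd (ext c) = ext (boundary c).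
Proof.
have cK := @ext_supported _ c.
apply/ffunP => F; rewrite -{2}[c]extK boundary_res // ext_res; last first.
  exact: bd_supported (@face_sub _ K) cK.
case: eqP => // cF; rewrite ffunE big1 // => v vF.
rewrite ffunE insubF ?mulr0 // cardsU1 vF eqSS.
by apply/negbTE; rewrite negb_and; apply/orP; right; apply/eqP.
Qed.

(** * Homology when the faces outside an acyclic part are maximal *)

Variables (L : {set {set V}}) (m : nat).
Hypothesis LK : L \subset faces K.
Hypothesis acyclicL : acyclic L.
Hypothesis maximalL : forall F v, F \in faces K -> F \notin L -> v \notin F ->
  v |: F \notin faces K.

Let C := [set F in faces K | (F \notin L) && (#|F| == m.+1)].

(** Coordinates of the relative chains modulo [L]; they induce the isomorphism. *)
Let coefs (c : tchain) : 'rV[int]_#|C| := \row_i c (enum_val i).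

Lemma coefsB c d : coefs (c - d) = coefs c - coefs d.
Proof. by apply/rowP => i; rewrite !mxE !ffunE. Qed.

(** A face outside [L] is a facet of no face, so no boundary involves it. *)
Lemma coefs_boundary (z : cycle_group K m) :
  z \in @boundary_pred V K m -> coefs (ext (val z)) = 0.
Proof.
rewrite inE => /asboolP[c <-]; apply/rowP => i; rewrite !mxE -bd_ext ffunE.
rewrite big1 // => v vF.
have := enum_valP i; rewrite inE => /and3P[FK FL _].
by rewrite ext_supported ?mulr0 //; apply: maximalL.
Qed.

(** Without coefficients on [C] the cycle is supported on [L], where it bounds. *)
Lemma boundary_coefs (z : cycle_group K m) :
  coefs (ext (val z)) = 0 -> z \in @boundary_pred V K m.
Proof.
move=> /rowP z0; rewrite inE; apply/asboolP.
have zL : supported L (ext (val z)).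
  move=> F FL; have [FC|] := boolP (F \in C).
    by have := z0 (enum_rank_in FC F); rewrite !mxE enum_rankK_in.
  rewrite inE FL negb_and /= => /orP[/ext_supported->//|cF].
  by rewrite ffunE insubF // (negPf cF) andbF.
have dz : bd (ext (val z)) = 0.
  case: z {z0 zL} => z /= zP; move: zP; rewrite inE bd_ext => /eqP->.
  by rewrite raddf0.
have [c cL dc] := acyclicL zL dz.
(* The filling [c] may mix degrees; [res] keeps its faces with [m.+2] vertices. *)
by exists (res _ c); rewrite boundary_res ?dc ?extK //; apply: supportedS cL.
Qed.

(** The chain [b] on [C] has its boundary in [L]. Filling that boundary by [c] in [L] makes [b - c]
    a cycle with the same coefficients on [C]. *)
Lemma coefs_surj (a : 'rV[int]_#|C|) :
  exists z : cycle_group K m, coefs (ext (val z)) = a.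
Proof.
pose b : tchain := [ffun F => \sum_(i | enum_val i == F) a 0 i].
have bC : supported C b.
  move=> F FC; rewrite ffunE big_pred0 // => i; apply: contraNF FC => /eqP <-.
  exact: enum_valP.
have CK : C \subset faces K by apply/subsetP => F; rewrite inE => /andP[].
have dbL : supported L (bd b).
  move=> F FL; rewrite ffunE big1 // => v vF; rewrite bC ?mulr0 //.
  apply/negP => /(subsetP CK) vK.
  have FK := face_sub vK (subsetUr _ _).
  by have := maximalL FK FL vF; rewrite vK.
have [c cL dc] := acyclicL dbL (bd_bd b).
have bcK : supported (faces K) (b - c).
  by apply: supportedB; [apply: supportedS bC | apply: supportedS cL].
have zP : res m.+1 (b - c) \in @cycle_pred V K m.
  rewrite inE boundary_res // raddfB /= dc subrr.
  by apply/eqP/ffunP => F; rewrite !ffunE.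
exists (Cycle zP); apply/rowP => i; rewrite mxE ext_res //.
have := enum_valP i; rewrite inE => /and3P[_ FL ->].
rewrite !ffunE (cL _ FL) subr0 (big_pred1 i) // => k.
by rewrite (inj_eq enum_val_inj).
Qed.

Local Open Scope quotient_scope.

Lemma homology_maximal_faces :
  isomorphic_zmod (reduced_homology K m) 'rV[int]_#|C|.
Proof.
pose f (x : reduced_homology K m) := coefs (ext (val (repr x))).
have fpi z : f (\pi z) = coefs (ext (val z)).
  apply/eqP; rewrite -subr_eq0 -coefsB -!raddfB; apply/eqP/coefs_boundary.
  by rewrite Quotient.idealrBE reprK.
have fB : zmod_morphism f.
  move=> x y; rewrite -[x]reprK -[y]reprK.
  by rewrite -raddfB !fpi -coefsB !raddfB.
pose fA := GRing.isZmodMorphism.Build _ _ f fB.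
pose F : {additive _ -> _} := HB.pack f fA.
exists F.
have /choice[g gP] : forall a, exists x, f x = a.
  by move=> a; have [z <-] := coefs_surj a; exists (\pi z).
exists g; last exact: gP.
move=> x; apply/eqP; rewrite -[x]reprK -[g _]reprK -Quotient.idealrBE.
apply: boundary_coefs; rewrite !raddfB coefsB.
by rewrite -/(f (g _)) gP /= reprK subrr.
Qed.

End GradedChains.

(** * Stars of the singleton blocks and critical faces *)

Section DisjointBlocks.
Variable n : nat.
Local Notation block := (nonempty_subset n).
Implicit Types (F : {set block}) (i k : 'I_n) (B : block).

Lemma set1_neq0 i : [set i] != set0.
Proof. by apply/set0Pn; exists i; rewrite inE. Qed.

Definition singleton i : block := Sub [set i] (set1_neq0 i).

Lemma mem_Dn F :
  reflect (forall B1 B2, B1 \in F -> B2 \in F -> B1 != B2 ->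
             [disjoint val B1 & val B2])
          (F \in faces (Dn n)).
Proof.
rewrite inE /partial_partition.
have -> : set0 \notin [set val B | B in F].
  by apply/imsetP => -[B _ e]; have := valP B; rewrite -e eqxx.
rewrite andbT; apply: (iffP (trivIsetP (P := _))) => [tF B1 B2 F1 F2 nB|dF].
  by apply: tF; rewrite ?imset_f // (inj_eq val_inj).
move=> _ _ /imsetP[B1 F1 ->] /imsetP[B2 F2 ->].
by rewrite (inj_eq val_inj); apply: dF.
Qed.

Lemma mem_Dn_setU1 B F : F \in faces (Dn n) ->
  (forall B', B' \in F -> B' != B -> [disjoint val B & val B']) ->
  B |: F \in faces (Dn n).
Proof.
move=> /mem_Dn dF dB; apply/mem_Dn => B1 B2.
move=> /setU1P[->|F1] /setU1P[->|F2]; rewrite ?eqxx //.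
- by rewrite eq_sym; apply: dB.
- by rewrite disjoint_sym; apply: dB.
- exact: dF.
Qed.

Lemma mem_Dn_singleton i F : F \in faces (Dn n) ->
  reflect (forall B, B \in F -> B != singleton i -> i \notin val B)
          (singleton i |: F \in faces (Dn n)).
Proof.
move=> FD; apply: (iffP idP) => [/mem_Dn d B BF nB|d].
  rewrite eq_sym in nB.
  by have := d _ _ (setU11 _ _) (setU1r _ BF) nB; rewrite disjoints1.
by apply: mem_Dn_setU1 => // B BF nB; rewrite disjoints1 d.
Qed.

(** Being a face is a pairwise condition, and distinct singletons are disjoint. *)
Lemma Dn_singletons_flag i k F :
  singleton i |: F \in faces (Dn n) -> singleton k |: F \in faces (Dn n) ->
  singleton i |: (singleton k |: F) \in faces (Dn n).
Proof.
move=> iF kF; apply: mem_Dn_setU1 => // B /setU1P[-> nik|BF nB].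
  rewrite disjoints1 inE; apply: contraNneq nik => ->; exact: eqxx.
by move/mem_Dn: iF; apply; rewrite ?setU11 ?setU1r // eq_sym.
Qed.

Definition singletons := [seq singleton i | i <- enum 'I_n].

(** A singleton block cannot be joined to [F] exactly when its element lies in some other block of
    [F]. *)
Lemma not_starsP F : F \in faces (Dn n) ->
  reflect (forall i, exists B, [/\ B \in F, B != singleton i & i \in val B])
          (F \notin stars (Dn n) singletons).
Proof.
move=> FD; rewrite [F \in stars _ _]inE FD /= -all_predC.
apply: (iffP allP) => [h i|h _ /mapP[i _ ->]] /=; last first.
  have [B [BF nB iB]] := h i.
  by apply/(mem_Dn_singleton i FD) => /(_ B BF nB); rewrite iB.
apply: contrapT => nB.
have /negP[] := h (singleton i) (map_f _ (mem_enum _ i)).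
apply/(mem_Dn_singleton i FD) => B BF nBi; apply/negP => iB.
by apply: nB; exists B.
Qed.

(** Any new block contains an element that some block of [F] already covers. *)
Lemma Dn_critical_maximal F B : F \in faces (Dn n) ->
  F \notin stars (Dn n) singletons -> B \notin F -> B |: F \notin faces (Dn n).
Proof.
move=> FD /(not_starsP FD) cF BF; have /set0Pn[i iB] := valP B.
have [B' [B'F _ iB']] := cF i.
apply/mem_Dn => /(_ B B' (setU11 _ _) (setU1r _ B'F)).
have -> : B != B' by apply: contraNneq BF => ->.
by move=> /(_ isT) /disjointFr /(_ iB); rewrite iB'.
Qed.

Lemma card_critical j :
  #|[set F in faces (Dn n) | (F \notin stars (Dn n) singletons) && (#|F| == j)]|
  = num_nosingleton_partitions n j.
Proof.
have inj_blocks : injective (fun F => [set val B | B in F]).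
  exact: imset_inj val_inj.
rewrite -(card_imset _ inj_blocks); apply: eq_card => P.
rewrite [RHS]inE; apply/imsetP/and3P.
  case=> F; rewrite inE => /and3P[FD /(not_starsP FD) cF cardF] ->.
  have := FD; rewrite inE => /andP[tF F0].
  split; last 1 first.
  (* A singleton block would meet the other block [B'] that contains its element. *)
  - apply/forall_inP => _ /imsetP[B BF ->]; apply/cards1P => -[i eB].
    have [B' [B'F nB' iB']] := cF i.
    have eBi : B = singleton i by apply: val_inj.
    have := mem_Dn _ FD B' B B'F BF; rewrite eBi => /(_ nB').
    by move=> /disjointFr /(_ iB'); rewrite inE eqxx.
  - rewrite /partition tF F0 !andbT eqEsubset subsetT; apply/subsetP => i _.
    have [B [BF _ iB]] := cF i.
    by apply/bigcupP; exists (val B); rewrite ?imset_f.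
  - by rewrite card_imset //; apply: val_inj.
case=> /and3P[/eqP covP tP P0] cardP /forall_inP nP.
(* The vertices form a subtype, so [P] is pulled back to it; no block is lost, as [P] omits
   [set0]. *)
pose F := [set B : block | val B \in P].
have PE : P = [set val B | B in F].
  apply/setP => S; apply/idP/imsetP => [SP|[B]]; last by rewrite inE => ? ->.
  have nS : S != set0 by apply: contraNneq P0 => <-.
  by exists (Sub S nS : block); rewrite ?inE.
have FD : F \in faces (Dn n) by rewrite inE /partial_partition -PE tP.
exists F => //; rewrite inE FD andTb; apply/andP; split; last first.
  by move: cardP; rewrite {1}PE card_imset //; apply: val_inj.
apply/(not_starsP FD) => i.
have : i \in cover P by rewrite covP inE.
rewrite PE => /bigcupP[_ /imsetP[B BF ->] iB]; exists B; split=> //.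
apply: contraTneq BF => ->; rewrite inE.
by apply/negP => /nP; rewrite cards1.
Qed.

End DisjointBlocks.

Theorem theorem3p4 (n j : nat) (hj : 1 <= j <= n) :
  isomorphic_zmod (reduced_homology (Dn n) j.-1)
                  'rV[int]_(num_nosingleton_partitions n j).
Proof.
(* Homology in dimension [m] is read off the faces with [m.+1] blocks, so [j] is [m.+1]. *)
case: j hj => // m _; rewrite -card_critical.
apply: homology_maximal_faces.
- by apply/subsetP => F; rewrite inE => /andP[].
- apply: acyclic_stars => _ _ F /mapP[i _ ->] /mapP[k _ ->].
  exact: Dn_singletons_flag.
- exact: Dn_critical_maximal.
Qed.
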